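(* Fix $n,r\ge1$ and $0\le k\le n$. Then \[ \dim\mathcal{S}_r^-\Lambda^k(\mathbb{R}^n)=\dim\mathcal{P}_r^-\Lambda^k(\mathbb{R}^n)+\dim\mathcal{J}_r\Lambda^k(\mathbb{R}^n)+\dim\mathcal{J}_r\Lambda^{k-1}(\mathbb{R}^n), \] where $\dim\mathcal{P}_r^-\Lambda^k(\mathbb{R}^n)=\binom{r+n}{r+k}\binom{r+k-1}{k}$ and $\mathcal{J}_r\Lambda^{-1}:=0$.
   Context: Fix $n\ge1$. For a multi-index $\alpha\in\mathbb{N}^n$ and a subset $\sigma=\{\sigma(1)<\dots<\sigma(k)\}\subset\{1,\dots,n\}$, the form monomial is $x^\alpha dx_\sigma:=x_1^{\alpha_1}\cdots x_n^{\alpha_n}\,dx_{\sigma(1)}\wedge\cdots\wedge dx_{\sigma(k)}$, of degree $|\alpha|$. $\mathcal{H}_r\Lambda^k(\mathbb{R}^n)$ is the span of form monomials with $|\alpha|=r$, $|\sigma|=k$ (it is $0$ if $r<0$ or $k\notin\{0,\dots,n\}$), and $\mathcal{P}_r\Lambda^k:=\bigoplus_{j=0}^r\mathcal{H}_j\Lambda^k$ ($=0$ if $r<0$). $d$ is the exterior derivative. The Koszul operator $\kappa$ is defined on monomials by $\kappa(x^\alpha dx_\sigma)=\sum_{i=1}^k(-1)^{i+1}x^\alpha x_{\sigma(i)}\,dx_{\sigma(1)}\wedge\cdots\wedge\widehat{dx_{\sigma(i)}}\wedge\cdots\wedge dx_{\sigma(k)}$ and extended linearly. The trimmed polynomial space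 is $\mathcal{P}_r^-\Lambda^k:=\mathcal{P}_{r-1}\Lambda^k\oplus\kappa\,\mathcal{H}_{r-1}\Lambda^{k+1}$. The linear degree is $\mathrm{ldeg}(x^\alpha dx_\sigma):=\#\{i\notin\sigma:\alpha_i=1\}$, and $\mathcal{H}_{r,l}\Lambda^k$ is the span of form monomials in $\mathcal{H}_r\Lambda^k$ with linear degree $\ge l$. Define $\mathcal{J}_r\Lambda^k:=\sum_{l\ge1}\kappa\,\mathcal{H}_{r+l-1,l}\Lambda^{k+1}$, the serendipity space $\mathcal{S}_r\Lambda^k:=\mathcal{P}_r\Lambda^k+\mathcal{J}_r\Lambda^k+d\,\mathcal{J}_{r+1}\Lambda^{k-1}$ (forms of degree $-1$ or $n+1$ are $0$), and for $r\ge1$ the trimmed serendipity space $\mathcal{S}_r^-\Lambda^k:=\mathcal{S}_{r-1}\Lambda^k+\kappa\,\mathcal{S}_{r-1}\Lambda^{k+1}$, all on $\mathbb{R}^n$. *)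

(* Defs.v *)
(* Polynomial differential forms on R^n, represented in a
   finite-dimensional ambient space with per-variable exponent cutoff N. *)
From HB Require Import structures.
From mathcomp Require Import all_boot all_order all_algebra.
Unset Printing Implicit Defensive.
Import GRing.Theory.
Local Open Scope ring_scope.

(* Index of a form monomial x^alpha dx_sigma: exponents alpha_i in {0..N}
   and sigma a subset of {0..n-1} (0-based variables). *)
Definition idx (n N : nat) : finType :=
  ({ffun 'I_n -> 'I_N.+1} * {set 'I_n})%type.

Notation form R n N := {ffun idx n N -> R^o}.

Definition mdeg n N (a : {ffun 'I_n -> 'I_N.+1}) : nat := (\sum_i (a i : nat))%N.

Definition ldeg n N (t : idx n N) : nat :=
  #|[set i | (i \notin t.2) && ((t.1 i : nat) == 1%N)]|.

(* the form monomial x^a dx_s, for a : 'I_n -> nat (zero if some a_i > N) *)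
Definition monoN (R : fieldType) n N (a : 'I_n -> nat) (s : {set 'I_n})
  : form R n N :=
  [ffun t : idx n N => (([forall i, (t.1 i : nat) == a i]) && (t.2 == s))%:R].

Definition mono (R : fieldType) n N (t : idx n N) : form R n N :=
  monoN R n N (fun i => (t.1 i : nat)) t.2.

Definition pos n (s : {set 'I_n}) (i : 'I_n) : nat :=
  #|[set j in s | (j < i)%N]|.

Definition kappa_mono (R : fieldType) n N (t : idx n N) : form R n N :=
  \sum_(s in t.2)
     ((-1) ^+ pos n t.2 s) *: monoN R n N (fun i => ((t.1 i : nat) + (i == s))%N) (t.2 :\ s).

(* exterior derivative on a monomial: sum_i alpha_i x^(alpha - e_i) dx_i /\ dx_sigma *)
Definition d_mono (R : fieldType) n N (t : idx n N) : form R n N :=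
  \sum_(i | i \notin t.2)
     (((t.1 i : nat)%:R * (-1) ^+ pos n t.2 i) : R) *:
        monoN R n N (fun j => ((t.1 j : nat) - (j == i))%N) (i |: t.2).

Definition kappa (R : fieldType) n N (f : form R n N) : form R n N :=
  \sum_(t : idx n N) (f t : R) *: kappa_mono R n N t.
Definition extd (R : fieldType) n N (f : form R n N) : form R n N :=
  \sum_(t : idx n N) (f t : R) *: d_mono R n N t.

Definition kappaL (R : fieldType) n N : 'End(form R n N) := linfun (kappa R n N).
Definition extdL (R : fieldType) n N : 'End(form R n N) := linfun (extd R n N).

Definition Hsp (R : fieldType) n N (r k : nat) : {vspace form R n N} :=
  << map (mono R n N)
       (filter (fun t : idx n N => (mdeg n N t.1 == r) && (#|t.2| == k)) (enum (idx n N))) >>%VS.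

Definition Hlsp (R : fieldType) n N (r l k : nat) : {vspace form R n N} :=
  << map (mono R n N)
       (filter (fun t : idx n N =>
          [&& mdeg n N t.1 == r, #|t.2| == k & (l <= ldeg n N t)%N]) (enum (idx n N))) >>%VS.

Definition Psp (R : fieldType) n N (r k : nat) : {vspace form R n N} :=
  (\sum_(j < r.+1) Hsp R n N j k)%VS.

(* J_r Lambda^k = sum_{l>=1} kappa H_{r+l-1,l} Lambda^{k+1};
   terms with l > n vanish since ldeg <= n. *)
Definition Jsp (R : fieldType) n N (r k : nat) : {vspace form R n N} :=
  (\sum_(1 <= l < n.+1) (kappaL R n N @: Hlsp R n N (r + l - 1) l k.+1))%VS.

Definition Ssp (R : fieldType) n N (r k : nat) : {vspace form R n N} :=
  (Psp R n N r k + Jsp R n N r k +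
     (if k is k'.+1 then extdL R n N @: Jsp R n N r.+1 k' else 0))%VS.

Definition Smsp (R : fieldType) n N (r k : nat) : {vspace form R n N} :=
  (Ssp R n N r.-1 k + kappaL R n N @: Ssp R n N r.-1 k.+1)%VS.

Definition Pmsp (R : fieldType) n N (r k : nat) : {vspace form R n N} :=
  (Psp R n N r.-1 k + kappaL R n N @: Hsp R n N r.-1 k.+1)%VS.

(* Main.v *)
(** The homotopy formula [kappa d + d kappa = r + k] on [H_r Lambda^k], together with
   [kappa kappa = 0], makes [kappa d] act on each homogeneous piece of [J_r Lambda^k] as a
   nonzero scalar.  Hence [kappa (d J_r) = J_r], so [d] is injective on [J_r], [d J_r]
   meets [ker kappa] trivially, and
     [S^-_r Lambda^k
        = P_(r-1) Lambda^k + kappa H_(r-1) Lambda^(k+1) + J_r Lambda^k + d J_r Lambda^(k-1)].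
   The first summand lives in degrees [< r], the second in degree [r], the third in
   degrees [> r]; the second and third lie in [ker kappa], the fourth avoids it.  So the
   sum is direct.  The homotopy formula also makes the Koszul complex exact, and
   rank-nullity then gives [dim kappa H_r Lambda^k] by induction on [r]. *)
Require Import Defs.
From HB Require Import structures.
From mathcomp Require Import all_boot all_order all_algebra.
From mathcomp Require Import zify ring.

Set Implicit Arguments.
Unset Strict Implicit.

Section Forms.

Import GRing.Theory Num.Theory.
Local Open Scope ring_scope.

Variables (R : numFieldType) (n N : nat).

Local Notation form := {ffun Defs.idx n N -> R^o}.
Local Notation idx := (Defs.idx n N).
Local Notation deg t := (mdeg n N t.1).
Local Notation monoN := (monoN R n N).
Local Notation mono := (mono R n N).
Local Notation kappa := (kappa R n N).
Local Notation extd := (extd R n N).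
Local Notation kappaL := (kappaL R n N).
Local Notation extdL := (extdL R n N).
Local Notation pos := (pos n).

Implicit Types (f g : form) (t u : idx) (a b : 'I_n -> nat) (s : {set 'I_n}).

(** * Linearity of [kappa] and [extd], and expansion in form monomials *)

Lemma kappa_is_linear : linear kappa.
Proof.
move=> c f g; rewrite /Defs.kappa scaler_sumr -big_split /=.
by apply: eq_bigr => t _; rewrite !ffunE scalerDl scalerA.
Qed.
HB.instance Definition _ :=
  GRing.isLinear.Build R form form _ kappa kappa_is_linear.

Lemma extd_is_linear : linear extd.
Proof.
move=> c f g; rewrite /Defs.extd scaler_sumr -big_split /=.
by apply: eq_bigr => t _; rewrite !ffunE scalerDl scalerA.
Qed.
HB.instance Definition _ :=
  GRing.isLinear.Build R form form _ extd extd_is_linear.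

Lemma kappaZ (c : R) f : kappa (c *: f) = c *: kappa f.
Proof. exact: linearZ. Qed.

Lemma kappa_sum (I : finType) (P : pred I) (F : I -> form) :
  kappa (\sum_(i | P i) F i) = \sum_(i | P i) kappa (F i).
Proof. exact: raddf_sum. Qed.

Lemma extdZ (c : R) f : extd (c *: f) = c *: extd f.
Proof. exact: linearZ. Qed.

Lemma extd_sum (I : finType) (P : pred I) (F : I -> form) :
  extd (\sum_(i | P i) F i) = \sum_(i | P i) extd (F i).
Proof. exact: raddf_sum. Qed.

Lemma kappaLE f : kappaL f = kappa f.
Proof. by rewrite /Defs.kappaL lfunE. Qed.

Lemma extdLE f : extdL f = extd f.
Proof. by rewrite /Defs.extdL lfunE. Qed.

Lemma eq_monoN a b s : a =1 b -> monoN a s = monoN b s.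
Proof.
move=> eq_ab; apply/ffunP => t; rewrite !ffunE.
by under eq_forallb => i do rewrite eq_ab.
Qed.

Lemma monoE t u : mono t u = (t == u)%:R.
Proof.
rewrite /Defs.mono !ffunE; congr (_%:R); congr nat_of_bool.
apply/andP/eqP => [[/forallP eq1 /eqP eq2]|->]; last by split=> //; apply/forallP.
case: t u eq1 eq2 => [a s] [b s'] /= eq1 ->; congr pair.
by apply/ffunP => i; apply/val_inj; rewrite /= (eqP (eq1 i)).
Qed.

Lemma form_sum f : f = \sum_t (f t : R) *: mono t.
Proof.
apply/ffunP => u; rewrite sum_ffunE (bigD1 u) //= big1 ?addr0 => [|t neq_tu].
  by rewrite ffunE monoE eqxx; exact/esym/mulr1.
by rewrite ffunE monoE (negPf neq_tu); exact: mulr0.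
Qed.

Lemma linear_mono_eq0 (g : {linear form -> form}) :
  (forall t, g (mono t) = 0) -> forall f, g f = 0.
Proof.
move=> g0 f; rewrite (form_sum f) linear_sum big1 // => t _.
by rewrite linearZ /= g0 scaler0.
Qed.

Lemma kappa_mono t : kappa (mono t) = kappa_mono R n N t.
Proof.
rewrite /Defs.kappa (bigD1 t) // big1 => [|u /= neq_ut].
  by rewrite monoE eqxx scale1r /= addr0.
by rewrite monoE eq_sym (negPf neq_ut) scale0r.
Qed.

Lemma extd_mono t : extd (mono t) = d_mono R n N t.
Proof.
rewrite /Defs.extd (bigD1 t) // big1 => [|u /= neq_ut].
  by rewrite monoE eqxx scale1r /= addr0.
by rewrite monoE eq_sym (negPf neq_ut) scale0r.
Qed.

Lemma monoN_overflow a s i : (N < a i)%N -> monoN a s = 0.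
Proof.
move=> lt_N_ai; apply/ffunP => t; rewrite !ffunE.
case: forallP => // /(_ i)/eqP eq_ti.
by move: lt_N_ai; rewrite -eq_ti ltnNge -ltnS ltn_ord.
Qed.

Lemma monoN_mono a s : (forall i, a i <= N)%N ->
  {t : idx | monoN a s = mono t & (forall i, t.1 i = a i :> nat) /\ t.2 = s}.
Proof.
move=> le_aN; exists ([ffun i => inord (a i)], s).
  by apply: eq_monoN => i; rewrite ffunE inordK ?ltnS.
by split=> // i; rewrite ffunE inordK ?ltnS.
Qed.

Lemma kappa_monoN a s :
  kappa (monoN a s) =
    \sum_(i in s) (-1) ^+ pos s i *: monoN (fun j => (a j + (j == i))%N) (s :\ i).
Proof.
case: (pickP (fun i => N < a i)%N) => [i lt_N_ai|le_aN].
  rewrite (monoN_overflow _ lt_N_ai) raddf0 big1 // => j _.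
  by rewrite (@monoN_overflow _ _ i) ?scaler0 // ltn_addr.
case: (@monoN_mono a s) => [i|t -> [eq_a <-]]; first by rewrite leqNgt le_aN.
rewrite kappa_mono; apply: eq_bigr => i _; congr (_ *: _).
by apply: eq_monoN => j; rewrite eq_a.
Qed.

(** Since [extd] lowers exponents, an exponent [N + 1] would make the left side zero and could leave
    a nonzero term on the right. In [kappa_monoN] exponents only grow, so an overflow kills both
    sides. *)
Lemma extd_monoN a s : (forall i, a i <= N)%N ->
  extd (monoN a s) =
    \sum_(i | i \notin s) ((a i)%:R * (-1) ^+ pos s i) *:
       monoN (fun j => (a j - (j == i))%N) (i |: s).
Proof.
move=> le_aN; case: (monoN_mono s le_aN) => t -> [eq_a <-].
rewrite extd_mono; apply: eq_bigr => i _; rewrite eq_a; congr (_ *: _).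
by apply: eq_monoN => j; rewrite eq_a.
Qed.

(** * Koszul signs, the complex property of [kappa], and the homotopy formula on monomials *)

Lemma pos_setD1 s i j : i \in s -> pos s j = ((i < j) + pos (s :\ i) j)%N.
Proof. move=> si; rewrite /Defs.pos (cardsD1 i).
by rewrite inE si; congr addn; apply: eq_card => l; rewrite !inE andbA.
Qed.

Lemma pos_setU1 s i j : i \notin s -> pos (i |: s) j = ((i < j) + pos s j)%N.
Proof. by move=> iNs; rewrite (@pos_setD1 _ i) ?setU11 ?setU1K. Qed.

Lemma sign_lt_swap (i j : 'I_n) : i != j ->
  (-1) ^+ (i < j)%N = - (-1) ^+ (j < i)%N :> R.
Proof.
by rewrite -(inj_eq val_inj) neq_ltn => /orP[]lt_ij; rewrite lt_ij ltnNge ltnW ?opprK.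
Qed.

Lemma kappaK f : kappa (kappa f) = 0.
Proof.
suff kappaK_mono t : kappa (kappa (mono t)) = 0.
  exact: (@linear_mono_eq0 (kappa \o kappa)).
set a := fun i => t.1 i : nat; set s := t.2; rewrite -[mono t]/(monoN a s).
(* [F i j] is the term that removes [dx_i] first and [dx_j] second. Swapping the order gives the
   same monomial, and exactly one of the two position signs flips. *)
pose F i j := ((-1) ^+ pos s i * (-1) ^+ pos (s :\ i) j : R) *:
  monoN (fun l => (a l + (l == i) + (l == j))%N) (s :\ i :\ j).
have -> : kappa (kappa (monoN a s)) =
    \sum_(i in s) \sum_(j in s | j != i) F i j.
  rewrite kappa_monoN kappa_sum; apply: eq_bigr => i si.
  rewrite kappaZ kappa_monoN scaler_sumr.
  apply: eq_big => [j|j _]; first by rewrite !inE andbC.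
  by rewrite scalerA.
have F_anti i j : i \in s -> j \in s -> j != i -> F j i = - F i j.
  move=> si sj neq_ji; rewrite /F -scaleNr; congr (_ *: _); last first.
    rewrite setDDl setUC -setDDl.
    by apply: eq_monoN => l; rewrite addnAC.
  rewrite (@pos_setD1 s j i) // (@pos_setD1 s i j) // !exprD.
  rewrite (sign_lt_swap neq_ji); ring.
(* Antisymmetry yields only [2 S = 0]; characteristic zero then gives [S = 0]. *)
set S := LHS; suff: S = - S.
  move/eqP; rewrite -subr_eq0 opprK -mulr2n -scaler_nat scaler_eq0 pnatr_eq0.
  by move/eqP.
rewrite {1}/S [LHS](exchange_big_dep (mem s)) /= => [|i j _ /andP[] //].
rewrite -sumrN; apply: eq_bigr => j sj.
rewrite -sumrN; apply: eq_big => [i|i]; first by rewrite sj eq_sym.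
by case/and3P=> si _ neq_ji; rewrite (F_anti j i) // eq_sym.
Qed.

(* At degree [N] the exponent cutoff may kill terms of [kappa (mono t)]. *)
Lemma homotopy_mono t : (deg t < N)%N ->
  kappa (extd (mono t)) + extd (kappa (mono t)) = (deg t + #|t.2|)%:R *: mono t.
Proof.
move=> deg_lt; set a := fun i => t.1 i : nat; set s := t.2.
rewrite -[mono t]/(monoN a s).
have le_a i : (a i <= deg t)%N by rewrite /mdeg (bigD1 i) //= leq_addr.
(* [F i j] inserts [dx_i] by [extd] and then removes [dx_j] by [kappa]. The diagonal term, which
   removes the [dx_i] just inserted, restores the monomial with factor [a i]. *)
pose F i j := (a i)%:R * ((-1) ^+ pos s i * (-1) ^+ pos (i |: s) j) *:
  monoN (fun l => (a l - (l == i) + (l == j))%N) ((i |: s) :\ j).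
have -> : kappa (extd (monoN a s)) =
    \sum_(i | i \notin s) ((a i)%:R *: monoN a s + \sum_(j in s) F i j).
  rewrite extd_monoN => [|i]; last exact: leq_trans (ltnW deg_lt).
  rewrite kappa_sum; apply: eq_bigr => i iNs.
  rewrite kappaZ kappa_monoN scaler_sumr (big_setU1 _ iNs) /=; congr (_ + _).
    rewrite scalerA pos_setU1 // ltnn add0n setU1K //.
    (* At [a i = 0] the truncated [a i - 1 + 1] is not [a i], but the coefficient vanishes. *)
    case: (posnP (a i)) => [->|a_gt0]; first by rewrite !mul0r !scale0r.
    rewrite -mulrA -expr2 sqrr_sign mulr1; congr (_ *: _).
    by apply: eq_monoN => l; case: eqP => [->|_] /=; lia.
  by apply: eq_bigr => j _; rewrite scalerA /F mulrA.
(* In the opposite order the off-diagonal terms are the same up to sign. The diagonal now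
   differentiates the exponent already raised by [kappa], hence the factor [a j + 1]. *)
have -> : extd (kappa (monoN a s)) =
    \sum_(j in s) ((a j).+1%:R *: monoN a s - \sum_(i | i \notin s) F i j).
  rewrite kappa_monoN extd_sum; apply: eq_bigr => j sj.
  (* The raised exponent is at most [deg t + 1], so the strict bound [deg t < N] keeps it within the
     cutoff. *)
  rewrite extdZ extd_monoN => [|i]; last first.
    by rewrite (leq_trans _ deg_lt) // -addn1 leq_add // leq_b1.
  rewrite scaler_sumr (bigD1 j) ?setD11 //=; congr (_ + _).
    rewrite scalerA setD1K // (@pos_setD1 s j j) // ltnn add0n eqxx addn1.
    rewrite mulrCA -expr2 sqrr_sign mulr1; congr (_ *: _).
    by apply: eq_monoN => l; rewrite addnK.
  rewrite -sumrN; apply: eq_big => [i|i].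
    by rewrite !inE; case: eqP => [->|_] /=; rewrite ?sj ?andbT.
  rewrite !inE negb_and negbK => /andP[]; case: eqP => //= neq_ij iNs _.
  rewrite scalerA /F -scaleNr.
  have neq_ij' : i != j by exact/eqP.
  rewrite pos_setU1 // (@pos_setD1 s j i) // !exprD (sign_lt_swap neq_ij').
  have -> : (i |: s) :\ j = i |: s :\ j.
    apply/setP => l; rewrite !inE; case: (eqVneq l j) => [->|_] //=.
    by rewrite eq_sym (negPf neq_ij').
  rewrite addn0.
  have -> : monoN (fun l => (a l + (l == j) - (l == i))%N) (i |: s :\ j)
    = monoN (fun l => (a l - (l == i) + (l == j))%N) (i |: s :\ j).
    apply: eq_monoN => l; case: (eqVneq l i) => [->|_] /=; last by rewrite !subn0.
    by rewrite (negPf neq_ij') !addn0.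
  by congr (_ *: _); case: (j < i)%N; ring.
(* The off-diagonal sums cancel. The scalar left is the sum of [a i] outside [s] plus the sum of
   [a j + 1] over [s], that is [deg t + #|s|]. *)
rewrite !big_split /= sumrN [X in _ + _ + (_ - X)]exchange_big /=.
rewrite addrACA subrr addr0 -!scaler_suml -scalerDl; congr (_ *: _).
rewrite -!natr_sum -natrD; congr (_%:R).
under [X in (_ + X)%N]eq_bigr do rewrite -addn1.
rewrite big_split /= sum1_card addnA; congr addn.
by rewrite /mdeg [RHS](bigID (mem s)) /= addnC.
Qed.

(** * Spans of monomials and subspaces cut out by degree conditions *)

Lemma mem_span_mono (s : seq idx) f :
  reflect (forall t, t \notin s -> f t = 0) (f \in <<map mono s>>%VS).
Proof.
apply: (iffP idP) => [f_s t tNs | f0].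
  rewrite [f](@coord_span _ _ _ (in_tuple (map mono s))) // sum_ffunE big1 // => i _.
  have lt_i : (i < size s)%N by rewrite -(size_map mono).
  rewrite (nth_map t) // ffunE monoE; case: eqP => [eq_t|_]; last exact: mulr0.
  by rewrite -eq_t mem_nth in tNs.
rewrite (form_sum f); apply: memv_suml => t _; case: (boolP (t \in s)) => [ts|/f0->].
  by rewrite memvZ // memv_span // map_f.
by rewrite scale0r mem0v.
Qed.

Lemma free_mono (s : seq idx) : uniq s -> free (map mono s).
Proof.
elim: s => [|t s IHs] /=; first by rewrite nil_free.
case/andP=> tNs /IHs free_s; rewrite free_cons free_s andbT.
apply/mem_span_mono => /(_ t tNs); rewrite monoE eqxx => /eqP.
by rewrite oner_eq0.
Qed.

(** The predicate sees the polynomial degree and the form degree. Inclusions of such spaces then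
    reduce to implications between predicates, and trivial intersections to their
    incompatibility. *)
Definition Gsp (p : nat -> nat -> bool) : {vspace form} :=
  <<map mono (filter (fun t : idx => p (deg t) #|t.2|) (enum idx))>>%VS.

Implicit Types p q : nat -> nat -> bool.

Lemma dim_Gsp p : \dim (Gsp p) = #|[pred t : idx | p (deg t) #|t.2| ]|.
Proof.
have free_p := free_mono (filter_uniq (fun t : idx => p (deg t) #|t.2|) (enum_uniq idx)).
by rewrite (eqP free_p) size_map cardE enumT.
Qed.

Lemma mem_Gsp p f :
  reflect (forall t, ~~ p (deg t) #|t.2| -> f t = 0) (f \in Gsp p).
Proof.
apply: (iffP (mem_span_mono _ _)) => f0 t.
  by move=> pNt; rewrite f0 // mem_filter (negPf pNt).
by rewrite mem_filter mem_enum andbT; apply: f0.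
Qed.

Lemma Gsp_sub p q : (forall m c, p m c -> q m c) -> (Gsp p <= Gsp q)%VS.
Proof.
move=> pq; apply/subvP => f /mem_Gsp f0; apply/mem_Gsp => t qNt.
by apply: f0; apply: contra qNt; apply: pq.
Qed.

Lemma Gsp_disjoint p q : (forall m c, p m c -> ~~ q m c) -> (Gsp p :&: Gsp q)%VS = 0%VS.
Proof.
move=> pNq; apply/eqP; rewrite -subv0; apply/subvP => f.
rewrite memv_cap memv0 => /andP[/mem_Gsp fp /mem_Gsp fq]; apply/eqP/ffunP => t.
by rewrite ffunE; case: (boolP (p (deg t) #|t.2|)) => [/pNq/fq|/fp].
Qed.

Lemma monoN_Gsp q a s : q (\sum_i a i)%N #|s| -> monoN a s \in Gsp q.
Proof.
case: (pickP (fun i => N < a i)%N) => [i lt_N_ai|le_aN] q_as.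
  by rewrite (monoN_overflow _ lt_N_ai) mem0v.
case: (@monoN_mono a s) => [i|t -> [eq_a eq_s]]; first by rewrite leqNgt le_aN.
rewrite memv_span // map_f // mem_filter mem_enum andbT eq_s /mdeg.
by under eq_bigr do rewrite eq_a.
Qed.

Lemma kappa_Gsp p q : (forall m c, p m c.+1 -> q m.+1 c) ->
  (kappaL @: Gsp p <= Gsp q)%VS.
Proof.
move=> pq; rewrite limg_span; apply/span_subvP => _ /mapP[_ /mapP[t + ->] ->].
rewrite mem_filter kappaLE => /andP[pt _].
rewrite /Defs.mono kappa_monoN; apply: memv_suml => i ti.
rewrite memvZ // monoN_Gsp // big_split /= (bigD1 i (F := fun j => nat_of_bool _)) //=.
rewrite eqxx [X in (_ + (_ + X))%N]big1 ?addn0 ?addn1 => [|j /negPf-> //].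
by apply: pq; move: pt; rewrite (cardsD1 i t.2) ti.
Qed.

Lemma extd_Gsp p q : (forall m c, p m.+1 c -> q m c.+1) ->
  (extdL @: Gsp p <= Gsp q)%VS.
Proof.
move=> pq; rewrite limg_span; apply/span_subvP => _ /mapP[_ /mapP[t + ->] ->].
rewrite mem_filter extdLE => /andP[pt _].
rewrite /Defs.mono extd_monoN => [|i]; last by rewrite -ltnS ltn_ord.
apply: memv_suml => i tNi.
(* For a zero exponent truncated subtraction would not lower the degree, but that term has
   coefficient zero. *)
case: (posnP (t.1 i)) => [->|ti_gt0]; first by rewrite mul0r scale0r mem0v.
rewrite memvZ // monoN_Gsp //.
rewrite cardsU1 tNi; apply: pq; move: pt; rewrite /mdeg.
congr (is_true (p _ _)); rewrite (bigD1 i) //= [in RHS](bigD1 i) //= eqxx.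
rewrite subn1 -addSn prednK //; congr addn; apply: eq_bigr => j /negPf->.
by rewrite subn0.
Qed.

Lemma kappa_img_ker (W : {vspace form}) : (kappaL @: W <= lker kappaL)%VS.
Proof.
by apply/subvP => _ /memv_imgP[f _ ->]; rewrite memv_ker !kappaLE kappaK.
Qed.

(** * The homotopy formula on homogeneous forms and exactness of the Koszul complex *)

Local Notation Hsp := (Hsp R n N).
Local Notation Hlsp := (Hlsp R n N).
Local Notation Psp := (Psp R n N).
Local Notation Jsp := (Jsp R n N).

Lemma HspE r k : Hsp r k = Gsp (fun m c => (m == r) && (c == k)).
Proof. by []. Qed.

Lemma homotopy r k f : (r < N)%N -> f \in Hsp r k ->
  kappa (extd f) + extd (kappa f) = (r + k)%:R *: f.
Proof.
move=> lt_rN; rewrite HspE => /mem_Gsp f_rk.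
have sumE (g : {linear form -> form}) : g f = \sum_t (f t : R) *: g (mono t).
  by rewrite {1}(form_sum f) linear_sum; apply: eq_bigr => t _; rewrite linearZ.
have -> : kappa (extd f) = _ := sumE (kappa \o extd).
have -> : extd (kappa f) = _ := sumE (extd \o kappa).
rewrite -big_split /=.
rewrite [in RHS](form_sum f) scaler_sumr; apply: eq_bigr => t _.
rewrite -scalerDr; case: (boolP ((deg t == r) && (#|t.2| == k))) => [|t_rk].
  case/andP=> /eqP deg_t /eqP card_t.
  by rewrite homotopy_mono ?deg_t // card_t !scalerA mulrC.
by rewrite (f_rk t t_rk) !scale0r scaler0.
Qed.

Lemma kappa_extd_ker r k f : (r < N)%N -> f \in Hsp r k -> kappa f = 0 ->
  kappa (extd f) = (r + k)%:R *: f.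
Proof.
move=> lt_rN f_rk kf0; rewrite -homotopy // kf0.
by rewrite (raddf0 extd) addr0.
Qed.

Lemma kappa_Hsp r k : (kappaL @: Hsp r k.+1 <= Hsp r.+1 k)%VS.
Proof. by rewrite !HspE; apply: kappa_Gsp => m c; rewrite !eqSS. Qed.

Lemma extd_Hsp r k : (extdL @: Hsp r.+1 k <= Hsp r k.+1)%VS.
Proof. by rewrite !HspE; apply: extd_Gsp => m c; rewrite !eqSS. Qed.

Lemma limg_scale (g : 'End(form)) (c : R) (W : {vspace form}) : c != 0 ->
  (forall f, f \in W -> g f = c *: f) -> (g @: W)%VS = W.
Proof.
move=> c_neq0 gE; apply/eqP; rewrite eqEsubv; apply/andP; split; apply/subvP => f.
  by case/memv_imgP => h hW ->; rewrite gE // memvZ.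
move=> fW; have -> : f = g (c^-1 *: f).
  by rewrite gE ?memvZ // scalerA divff ?scale1r.
by rewrite memv_img // memvZ.
Qed.

(** A form [f] killed by [kappa] is [kappa (extd f)] divided by [r + 1 + k], a scalar that is
    nonzero even for [k = 0]. *)
Lemma kappa_ker_Hsp r k : (r.+1 < N)%N ->
  (Hsp r.+1 k :&: lker kappaL)%VS = (kappaL @: Hsp r k.+1)%VS.
Proof.
move=> lt_rN; apply/eqP; rewrite eqEsubv; apply/andP; split; last first.
  by rewrite subv_cap kappa_Hsp kappa_img_ker.
apply/subvP => f; rewrite memv_cap memv_ker kappaLE => /andP[f_rk /eqP kf0].
have := kappa_extd_ker lt_rN f_rk kf0.
move/(congr1 (fun h => (r.+1 + k)%:R^-1 *: h)).
rewrite scalerA mulVf ?pnatr_eq0 // scale1r => <-.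
rewrite -kappaLE memvZ // memv_img // -extdLE.
exact: (subvP (@extd_Hsp _ _)) (memv_img _ f_rk).
Qed.

(** Constant coefficients give [extd f = 0], so the homotopy formula reads [(k + 1) f = 0]. This is
    the base case for the dimension of [kappa] images. *)
Lemma kappa_ker_Hsp0 k : (0 < N)%N -> (Hsp 0 k.+1 :&: lker kappaL)%VS = 0%VS.
Proof.
move=> N_gt0; apply/eqP; rewrite -subv0.
apply/subvP => f; rewrite memv_cap memv_ker kappaLE => /andP[f_k /eqP kf0].
have := kappa_extd_ker N_gt0 f_k kf0.
(* The empty predicate encodes [extd f = 0]: no monomial has degree one below zero. *)
have : extdL f \in Gsp (fun _ _ => false).
  exact: (subvP (@extd_Gsp (fun m c => (m == 0) && (c == k.+1))%N _ _)) (memv_img _ f_k).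
move/mem_Gsp => df0; have -> : extd f = 0.
  by apply/ffunP => t; rewrite -extdLE df0 // ffunE.
rewrite (raddf0 kappa) => /esym/eqP; rewrite scaler_eq0 pnatr_eq0 /=.
by move/eqP->; rewrite mem0v.
Qed.

(** * Linear degree and the spaces [Jsp] *)

Lemma Hlsp_sub r l k : (Hlsp r l k <= Hsp r k)%VS.
Proof.
apply: sub_span => _ /mapP[t + ->]; rewrite mem_filter => /andP[/and3P[rt kt _] _].
by rewrite map_f // mem_filter rt kt mem_enum.
Qed.

Lemma Hlsp_anti r l k : (Hlsp r l.+1 k <= Hlsp r l k)%VS.
Proof.
apply: sub_span => _ /mapP[t + ->]; rewrite mem_filter => /andP[/and3P[rt kt lt] _].
by rewrite map_f // mem_filter rt kt (ltnW lt) mem_enum.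
Qed.

(** Linear degree counts variables outside [sigma], and only [n - k] of these exist. *)
Lemma Hlsp_eq0 r l k : (n < l + k)%N -> Hlsp r l k = 0%VS.
Proof.
move=> lt_n; apply/eqP; rewrite -subv0; apply/span_subvP => _ /mapP[t + ->].
rewrite mem_filter => /andP[/and3P[_ /eqP kt lt] _].
have : (ldeg n N t <= #|~: t.2|)%N.
  by apply/subset_leq_card/subsetP => i; rewrite !inE => /andP[].
by move: (cardsC t.2); rewrite card_ord kt; lia.
Qed.

Lemma kappa_Hlsp r l k : (0 < l)%N ->
  (kappaL @: Hlsp (r + l - 1) l k.+1 <= Hsp (r + l) k)%VS.
Proof.
move=> l_gt0; apply: subv_trans (limgS _ (Hlsp_sub _ _ _)) _.
have {2}-> : (r + l = (r + l - 1).+1)%N by lia.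
exact: kappa_Hsp.
Qed.

(* [kappa o d] acts on each homogeneous summand of [J_r Lambda^k] as a nonzero
   scalar; the summands with [l >= n - k] vanish, which keeps degrees below the cutoff. *)
Lemma kappa_extd_Jsp r k : (r + n <= N)%N ->
  (kappaL @: (extdL @: Jsp r k))%VS = Jsp r k.
Proof.
move=> le_N; rewrite /Defs.Jsp !limg_sum; apply: eq_big_nat => l /andP[l_gt0 _].
rewrite -limg_comp; case: (ltnP n (l + k.+1)) => [lt_n|le_n].
  by rewrite Hlsp_eq0 // !limg0.
(* The [l]-th summand has polynomial degree [r + l] and form degree [k]; the scalar is nonzero
   because [l > 0]. *)
apply: (@limg_scale _ (r + l + k)%:R); first by rewrite pnatr_eq0; lia.
move=> f fW; rewrite comp_lfunE kappaLE extdLE; apply: kappa_extd_ker.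
- lia.
- exact: (subvP (kappa_Hlsp _ _ l_gt0)).
by apply/eqP; rewrite -kappaLE -memv_ker (subvP (kappa_img_ker _) _ fW).
Qed.

(** A linear image never gains dimension; applied to [extd] and then to [kappa], which returns to
    [Jsp r k], this gives both inequalities. *)
Lemma dim_extd_Jsp r k : (r + n <= N)%N ->
  \dim (extdL @: Jsp r k) = \dim (Jsp r k).
Proof.
move=> le_N; apply/eqP; rewrite eqn_leq; apply/andP; split.
  by rewrite -(limg_ker_dim extdL (Jsp r k)) leq_addl.
rewrite -{1}(kappa_extd_Jsp k le_N).
by rewrite -(limg_ker_dim kappaL (extdL @: Jsp r k)) leq_addl.
Qed.

Lemma extd_Jsp_ker r k : (r + n <= N)%N ->
  (extdL @: Jsp r k :&: lker kappaL)%VS = 0%VS.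
Proof.
move=> le_N; apply/eqP; rewrite -dimv_eq0 -(eqn_add2r (\dim (Jsp r k))) add0n.
have := limg_ker_dim kappaL (extdL @: Jsp r k).
by rewrite kappa_extd_Jsp // dim_extd_Jsp // => ->.
Qed.

Lemma Jsp_subP r k (W : {vspace form}) :
  (forall l, (0 < l <= n)%N -> (kappaL @: Hlsp (r + l - 1) l k.+1 <= W)%VS) ->
  (Jsp r k <= W)%VS.
Proof.
move=> sub_W; rewrite /Defs.Jsp big_seq.
elim/big_ind: _ => [|U V UW VW|l]; first exact: sub0v.
  by rewrite subv_add UW.
by rewrite mem_index_iota; apply: sub_W.
Qed.

Lemma Jsp_ker r k : (Jsp r k <= lker kappaL)%VS.
Proof. by apply: Jsp_subP => l _; apply: kappa_img_ker. Qed.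

Lemma Jsp_Gsp r k : (Jsp r k <= Gsp (fun m _ => r < m)%N)%VS.
Proof.
apply: Jsp_subP => l /andP[l_gt0 _].
apply: subv_trans (kappa_Hlsp _ _ l_gt0) _.
rewrite HspE; apply: Gsp_sub => m c /andP[/eqP-> _]; lia.
Qed.

(** The summand [l = 1] is an image of forms of degree [r]. For [l >= 2], the [l]-th summand of
    [Jsp r k] lies in the summand [l - 1] of [Jsp r.+1 k]: the polynomial degree is the same and the
    linear degree condition is weaker. *)
Lemma Jsp_sub r k : (Jsp r k <= kappaL @: Hsp r k.+1 + Jsp r.+1 k)%VS.
Proof.
apply: Jsp_subP => -[//|[|l]] /= lt_l.
  by rewrite addnK (subv_trans _ (addvSl _ _)) // limgS // Hlsp_sub.
apply: subv_trans (addvSr _ _); apply: subv_trans (limgS _ (Hlsp_anti _ _ _)) _.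
rewrite /Defs.Jsp (big_rem l.+1) /=; last by rewrite mem_index_iota; lia.
have -> : (r + l.+2 - 1 = r.+1 + l.+1 - 1)%N by lia.
exact: addvSl.
Qed.

(** * The full polynomial spaces [Psp] *)

Lemma PspS r k : Psp r.+1 k = (Psp r k + Hsp r.+1 k)%VS.
Proof. by rewrite /Defs.Psp big_ord_recr. Qed.

Lemma Psp_Gsp r k : (Psp r k <= Gsp (fun m _ => m <= r)%N)%VS.
Proof.
apply/subv_sumP => j _; rewrite HspE; apply: Gsp_sub => m c /andP[/eqP-> _].
by rewrite -ltnS.
Qed.

Lemma Hsp_sub_Psp r j k : (j <= r)%N -> (Hsp j k <= Psp r k)%VS.
Proof.
by rewrite -ltnS => lt_j; rewrite (sumv_sup (Ordinal lt_j)).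
Qed.

(** Only the top homogeneous piece can leave [Psp r k] under [kappa]. *)
Lemma kappa_Psp r k :
  (kappaL @: Psp r k.+1 <= Psp r k + kappaL @: Hsp r k.+1)%VS.
Proof.
case: r => [|r]; first by rewrite /Defs.Psp big_ord1 addvSr.
rewrite {1}PspS limgD; apply: addvS => //; rewrite limg_sum.
apply/subv_sumP => j _; apply: subv_trans (kappa_Hsp _ _) _.
exact: Hsp_sub_Psp.
Qed.

(** * Direct sum decomposition of the trimmed serendipity space *)

Definition dJsp r k : {vspace form} :=
  (if k is k'.+1 then extdL @: Jsp r k' else 0)%VS.

Lemma dJsp_ker r k : (r + n <= N)%N -> (dJsp r k :&: lker kappaL)%VS = 0%VS.
Proof. by case: k => [|k] le_N; [rewrite cap0v | exact: extd_Jsp_ker]. Qed.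

Lemma dim_dJsp r k : (r + n <= N)%N ->
  \dim (dJsp r k) = (if k is k'.+1 then \dim (Jsp r k') else 0)%N.
Proof. by case: k => [|k] le_N; [rewrite dimv0 | exact: dim_extd_Jsp]. Qed.

Lemma dJsp_Gsp r k : (dJsp r k <= Gsp (fun m _ => r <= m)%N)%VS.
Proof.
case: k => [|k]; first exact: sub0v.
by apply: subv_trans (limgS _ (Jsp_Gsp _ _)) _; apply: extd_Gsp.
Qed.

Local Notation Smsp := (Smsp R n N).
Local Notation Pmsp := (Pmsp R n N).

(** Applying [kappa] to the serendipity space in form degree [k + 1] kills its [Jsp] part and turns
    its [extd] part into [Jsp r.+1 k]. The remaining [Jsp r k] is absorbed by [Jsp_sub], and [kappa]
    of [Psp] by [kappa_Psp]. *)
Lemma SmspE r k : (r.+1 + n <= N)%N ->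
  Smsp r.+1 k =
    (Psp r k + (kappaL @: Hsp r k.+1 + Jsp r.+1 k + dJsp r.+1 k))%VS.
Proof.
move=> le_N; rewrite /Defs.Smsp /Ssp -/(dJsp r.+1 k) [r.+1.-1]/=.
rewrite !limgD kappa_extd_Jsp //.
have -> : (kappaL @: Jsp r k.+1)%VS = 0%VS by apply/eqP; rewrite -lkerE Jsp_ker.
rewrite addv0; set P := Psp r k; set K := (kappaL @: Hsp r k.+1)%VS.
set J := Jsp r.+1 k; set D := dJsp _ _.
have K_le : (K <= kappaL @: Psp r k.+1)%VS by rewrite limgS // Hsp_sub_Psp.
have J_le : (Jsp r k <= K + J)%VS by exact: Jsp_sub.
have kP_le : (kappaL @: Psp r k.+1 <= P + K)%VS by exact: kappa_Psp.
apply/eqP; rewrite eqEsubv; apply/andP; split.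
  rewrite !subv_add -!andbA; apply/and5P; split.
  - exact: addvSl.
  - exact: subv_trans (subv_trans J_le (addvSl _ D)) (addvSr P _).
  - exact: subv_trans (addvSr _ D) (addvSr P _).
  - exact: subv_trans kP_le (addvS (subvv P) (subv_trans (addvSl K J) (addvSl _ D))).
  - exact: subv_trans (subv_trans (addvSr K J) (addvSl _ D)) (addvSr P _).
rewrite !subv_add -!andbA; apply/and4P; split.
- by rewrite -!addvA addvSl.
- exact: subv_trans (subv_trans K_le (addvSl _ J)) (addvSr _ _).
- exact: subv_trans (addvSr _ J) (addvSr _ _).
- exact: subv_trans (addvSr _ D) (addvSl _ _).
Qed.

Lemma dim_Pmsp r k :
  \dim (Pmsp r.+1 k) = (\dim (Psp r k) + \dim (kappaL @: Hsp r k.+1))%N.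
Proof.
rewrite /Defs.Pmsp /= dimv_disjoint_sum //; apply/eqP; rewrite -subv0.
apply: subv_trans (capvS (Psp_Gsp _ _) (kappa_Hsp _ _)) _.
rewrite HspE Gsp_disjoint // => m c; lia.
Qed.

Lemma dim_Smsp r k : (r.+1 + n <= N)%N ->
  \dim (Smsp r.+1 k) =
    (\dim (Pmsp r.+1 k) + \dim (Jsp r.+1 k) + \dim (dJsp r.+1 k))%N.
Proof.
move=> le_N; rewrite SmspE // dim_Pmsp.
set K := (kappaL @: _)%VS; set J := Jsp r.+1 k; set D := dJsp _ _.
have K_deg : (K <= Gsp (fun m _ => m == r.+1))%VS.
  apply: subv_trans (kappa_Hsp _ _) _; rewrite HspE; apply: Gsp_sub => m c.
  by case/andP.
(* [K] sits in degree exactly [r + 1] and [J] in strictly larger degrees. *)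
have KJ : (K :&: J)%VS = 0%VS.
  apply/eqP; rewrite -subv0; apply: subv_trans (capvS K_deg (Jsp_Gsp _ _)) _.
  by rewrite Gsp_disjoint // => m c /eqP->; rewrite ltnn.
(* Degrees do not separate [D] from [K + J]; the kernel of [kappa] does. *)
have KJ_D : ((K + J) :&: D)%VS = 0%VS.
  apply/eqP; rewrite -subv0 -(dJsp_ker k le_N) capvC capvS ?subvv //.
  by rewrite subv_add kappa_img_ker Jsp_ker.
have KJD_deg : (K + J + D <= Gsp (fun m _ => r < m)%N)%VS.
  rewrite !subv_add dJsp_Gsp andbT; apply/andP; split.
    by apply: subv_trans K_deg _; apply: Gsp_sub => m c /eqP->.
  by apply: subv_trans (Jsp_Gsp _ _) _; apply: Gsp_sub => m c /ltnW.
rewrite dimv_disjoint_sum; last first.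
  apply/eqP; rewrite -subv0; apply: subv_trans (capvS (Psp_Gsp _ _) KJD_deg) _.
  by rewrite Gsp_disjoint // => m c; rewrite leqNgt.
by rewrite !dimv_disjoint_sum // !addnA.
Qed.

End Forms.

(** * Binomial formulas for the dimensions *)

(** Exponents of total degree [r] are at most [r], so the cutoff [N] loses none of them, and they
    correspond to the tuples counted by [card_ord_partitions]. *)
Lemma card_exponents n N r : r <= N ->
  #|[pred a : {ffun 'I_n.+1 -> 'I_N.+1} | mdeg n.+1 N a == r]| = 'C(n + r, n).
Proof.
move=> le_rN; rewrite -card_ord_partitions.
pose widen (t : n.+1.-tuple 'I_r.+1) : {ffun 'I_n.+1 -> 'I_N.+1} :=
  [ffun i => widen_ord (le_rN : r < N.+1) (tnth t i)].
have widen_inj : injective widen.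
  move=> t u /ffunP eq_tu; apply: eq_from_tnth => i; apply/val_inj.
  by have /(congr1 val) := eq_tu i; rewrite !ffunE.
rewrite -(card_imset _ widen_inj); apply: eq_card => a; rewrite inE.
apply/eqP/imsetP => [deg_a|[t + ->]]; last first.
  rewrite inE big_tuple => /eqP <-; apply: eq_bigr => i _.
  by rewrite ffunE.
have le_a i : a i < r.+1.
  by rewrite ltnS -deg_a /mdeg (bigD1 i) //= leq_addr.
exists [tuple Ordinal (le_a i) | i < n.+1].
  rewrite inE big_tuple -[X in _ == X]deg_a; apply/eqP/eq_bigr => i _.
  by rewrite tnth_mktuple.
by apply/ffunP => i; rewrite ffunE tnth_mktuple; apply/val_inj.
Qed.

Lemma dim_Hsp (R : numFieldType) n N r k : r <= N ->
  \dim (Hsp R n.+1 N r k) = 'C(n + r, n) * 'C(n.+1, k).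
Proof.
move=> le_rN; rewrite HspE dim_Gsp -(card_exponents n le_rN).
have -> : 'C(n.+1, k) = #|[pred s : {set 'I_n.+1} | #|s| == k]|.
  by rewrite -[X in 'C(X, _)]card_ord -card_draws cardsE.
by rewrite -cardX; apply: eq_card => -[a s]; rewrite !inE.
Qed.

(* For [b > m] the truncated [m - b] is harmless, as ['C(m, b) = 0]. *)
Lemma bin_mul_bin m a b : 'C(m, a + b) * 'C(a + b, b) = 'C(m, b) * 'C(m - b, a).
Proof.
have [le_m|lt_m] := leqP (a + b) m; last first.
  rewrite bin_small //; have [lt_mb|le_bm] := ltnP m b; first by rewrite ['C(m, b)]bin_small.
  by rewrite ['C(m - b, a)]bin_small ?muln0 //; lia.
have -> : m = a + b + (m - (a + b)) by lia.
set c := m - (a + b).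
(* Both sides are the trinomial coefficient of [(a, b, c)]; multiplying by the three factorials
   clears denominators. *)
apply/eqP; rewrite -(eqn_pmul2r (_ : 0 < a`! * b`! * c`!)) ?muln_gt0 ?fact_gt0 //.
have e1 : 'C(a + b + c, a + b) * ((a + b)`! * c`!) = (a + b + c)`!.
  by rewrite -[in RHS](@bin_fact _ (a + b)) ?leq_addr // addKn.
have e2 : 'C(a + b, b) * (b`! * a`!) = (a + b)`!.
  by rewrite -[in RHS](@bin_fact _ b) ?leq_addl // addnK.
have e3 : 'C(a + b + c, b) * (b`! * (a + c)`!) = (a + b + c)`!.
  rewrite -[in RHS](@bin_fact _ b); last by lia.
  by congr (_ * (_ * _`!)); lia.
have e4 : 'C(a + c, a) * (a`! * c`!) = (a + c)`!.
  by rewrite -[in RHS](@bin_fact _ a) ?leq_addr // addKn.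
have -> : a + b + c - b = a + c by lia.
apply/eqP; transitivity (a + b + c)`!.
  by rewrite -e1 -e2; ring.
by rewrite -e3 -e4; ring.
Qed.

(** Induction on [r] for all [k]: by exactness the kernel of [kappa] in degree [r + 1] is the image
    from degree [r] and form degree [k + 2], and rank-nullity gives the rest. *)
Lemma dim_kappa_Hsp (R : numFieldType) n N r k : r < N ->
  \dim (kappaL R n.+1 N @: Hsp R n.+1 N r k.+1)
    = 'C(n.+1 + r, r + k.+1) * 'C(r + k, k).
Proof.
elim: r k => [|r IHr] k lt_rN.
  rewrite limg_dim_eq ?kappa_ker_Hsp0 // dim_Hsp // addn0 binn mul1n.
  by rewrite add0n addn0 binn muln1.
have := limg_ker_dim (kappaL R n.+1 N) (Hsp R n.+1 N r.+1 k.+1).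
rewrite kappa_ker_Hsp // IHr ?(ltnW lt_rN) // dim_Hsp ?(ltnW lt_rN) //.
(* The right sides are ['C(n + r.+1, n)] times ['C(n, k.+1)] and ['C(n, k)]; by Pascal's rule they
   add up to the dimension of [Hsp] in degree [r + 1]. *)
have := bin_mul_bin (n + r.+1) k.+1 r.+1; have := bin_mul_bin (n + r.+1) k r.+1.
have -> : 'C(k + r.+1, r.+1) = 'C(k + r.+1, k).
  by rewrite -bin_sub ?leq_addl // addnK.
have -> : 'C(k.+1 + r.+1, r.+1) = 'C(k.+1 + r.+1, k.+1).
  by rewrite -bin_sub ?leq_addl // addnK.
have -> : 'C(n + r.+1, r.+1) = 'C(n + r.+1, n).
  by rewrite -bin_sub ?leq_addl // addnK.
have -> : n.+1 + r.+1 = (n + r.+1).+1 by [].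
have -> : n.+1 + r = n + r.+1 by rewrite addnS.
have -> : r + k.+2 = (k + r.+1).+1 by lia.
have -> : r + k.+1 = k + r.+1 by lia.
have -> : r.+1 + k.+1 = (k + r.+1).+1 by lia.
have -> : r.+1 + k = k + r.+1 by lia.
rewrite addnK addSn !binS; lia.
Qed.

Lemma dim_Psp (R : numFieldType) n N r k : r <= N ->
  \dim (Psp R n.+1 N r k) = 'C(n.+1 + r, n.+1) * 'C(n.+1, k).
Proof.
elim: r => [|r IHr] le_rN.
  by rewrite /Psp big_ord1 dim_Hsp // !addn0 !binn.
rewrite PspS dimv_disjoint_sum ?IHr ?dim_Hsp ?(ltnW le_rN) //; last first.
  apply/eqP; rewrite -subv0; apply: subv_trans (capvS (Psp_Gsp R n.+1 N r k) (subvv _)) _.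
  rewrite HspE Gsp_disjoint // => m c; lia.
by rewrite -mulnDl; congr (_ * _); rewrite !addSn addnS [RHS]binS.
Qed.

(** All forms in these spaces have degree below [r + n], so under [r + n <= N] the exponent cutoff
    discards none of their monomials. *)
Theorem mainTheorem7 (R : realFieldType) (n N r k : nat) :
  (1 <= n)%N -> (1 <= r)%N -> (k <= n)%N -> (r + n <= N)%N ->
  \dim (Smsp R n N r k) =
    (\dim (Pmsp R n N r k) + \dim (Jsp R n N r k)
     + (if k is k'.+1 then \dim (Jsp R n N r k') else 0))%N
  /\ \dim (Pmsp R n N r k) = ('C(r + n, r + k) * 'C(r + k - 1, k))%N.
Proof.
case: n => // n; case: r => // r _ _ le_kn le_N.
have lt_rN : r < N by lia.
split; first by rewrite dim_Smsp // dim_dJsp.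
rewrite dim_Pmsp dim_Psp ?(ltnW lt_rN) // dim_kappa_Hsp //.
(* This rewrites the dimension of [Psp] with the factor ['C(r + k, k)] that the [kappa] image also
   carries; Pascal's rule then merges the two cofactors. *)
have := bin_mul_bin (n.+1 + r) k r.
have -> : 'C(k + r, r) = 'C(r + k, k).
  by rewrite -bin_sub ?leq_addl // addnK addnC.
have -> : 'C(n.+1 + r, r) = 'C(n.+1 + r, n.+1).
  by rewrite -bin_sub ?leq_addl // addnK.
rewrite addnK => <-.
have -> : r.+1 + k - 1 = r + k by lia.
have -> : r.+1 + n.+1 = (n.+1 + r).+1 by lia.
by rewrite -mulnDl addSn addnS (addnC k) addnC [in RHS]binS.
Qed.
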